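(* Let $\theta\in(0,1)$ be irrational with type $\eta=\eta(\theta)>1$, let $T_\theta(x)=x+\theta \pmod 1$ on $[0,1)$, and let $\mu$ be Lebesgue measure on $[0,1)$. Then for $\mu$-a.e. $x\in[0,1)$, $$\liminf_{r\to0}\frac{\log\tau_r(x)}{-\log r}=\dim_M(\mu)=1<\eta=\limsup_{r\to0}\frac{\log\tau_r(x)}{-\log r}.$$
   Context: For $t\in\mathbb R$, $\|t\|:=\min_{n\in\mathbb Z}|t-n|$. The type of an irrational $\theta$ is $\eta(\theta):=\sup\{\beta:\liminf_{n\to\infty}n^\beta\|n\theta\|=0\}\in[1,\infty]$. The cover time is $\tau_r(x):=\inf\{k:\ \forall y\in[0,1)\ \exists\,0\le j\le k\text{ with } d(T_\theta^j(x),y)<r\}$, where $[0,1)$ is regarded as the circle with $d(x,y)=\|x-y\|$. $\dim_M(\mu)$ is the common value of $\limsup_{r\to0}$ and $\liminf_{r\to0}$ of $\frac{\log M_\mu(r)}{\log r}$, where $M_\mu(r):=\min_{x\in\mathrm{supp}(\mu)}\mu(B(x,r))$. *)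

(* Defs.v *)
From HB Require Import structures.
From mathcomp Require Import all_boot all_order all_algebra.
From mathcomp Require Import all_classical all_reals all_analysis.

Set Implicit Arguments.
Unset Strict Implicit.
Unset Printing Implicit Defensive.

Import Order.TTheory GRing.Theory Num.Theory.
Import numFieldNormedType.Exports.

Local Open Scope classical_set_scope.
Local Open Scope ring_scope.

(* Points of the circle are represented by the reals of `[0, 1[. *)

Section circle_rotation.
Variable R : realType.
Implicit Types (t x y r theta beta : R) (n k j : nat).

Definition dist_int t : R := inf [set `|t - m%:~R| | m in [set: int]].

(* The infimum above is a minimum. *)
Lemma dist_intP t :
  (exists m : int, dist_int t = `|t - m%:~R|) /\
  (forall m : int, dist_int t <= `|t - m%:~R|).
Proof.
set A := [set `|t - m%:~R| | m in [set: int]].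
have lbA : has_lbound A by exists 0 => _ [m _ <-].
have le_dist m : dist_int t <= `|t - m%:~R| by apply: ge_inf => //; exists m.
split=> //.
suff [m mP] : exists m : int, forall m' : int, `|t - m%:~R| <= `|t - m'%:~R|.
  exists m; apply/eqP; rewrite eq_le le_dist /=.
  apply: lb_le_inf => [|_ [m' _ <-]]; last exact: mP.
  by exists `|t - m%:~R|, m.
set f := Num.floor t.
have f_le : f%:~R <= t by exact: floor_le.
have f_gt : t < (f + 1)%:~R by exact: floorD1_gt.
have below m' : m' <= f -> `|t - f%:~R| <= `|t - m'%:~R|.
  move=> m'f; have m'fR : m'%:~R <= f%:~R :> R by rewrite ler_int.
  rewrite !ger0_norm ?subr_ge0 //; last exact: le_trans f_le.
  by rewrite lerD2l lerN2.
have above m' : f < m' -> `|t - (f + 1)%:~R| <= `|t - m'%:~R|.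
  rewrite -lezD1 => m'f; have m'fR : (f + 1)%:~R <= m'%:~R :> R by rewrite ler_int.
  rewrite distrC (distrC t) !ger0_norm ?subr_ge0 ?(ltW f_gt) //.
    by rewrite lerD2r.
  exact: le_trans (ltW f_gt) m'fR.
have [fle|fgt] := leP `|t - f%:~R| `|t - (f + 1)%:~R|.
  exists f => m'; have [/below //|/above] := leP m' f; exact: le_trans.
exists (f + 1) => m'; have [/below|/above //] := leP m' f.
exact: le_trans (ltW fgt).
Qed.

Definition circle_dist x y : R := dist_int (x - y).

Definition circle_ball x r : set R :=
  [set y | (y \in `[0, 1[) /\ circle_dist x y < r].

Definition rotation theta x : R := x + theta - (Num.floor (x + theta))%:~R.

Definition irrational_type theta : \bar R :=
  ereal_sup [set beta%:E | beta in
    [set beta : R |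
      (limn_einf (fun n => (n%:R `^ beta * dist_int (n%:R * theta))%:E) = 0)%E]].

(* Equal to +oo when the orbit of x never becomes r-dense. *)
Definition cover_time theta r x : \bar R :=
  ereal_inf [set (k%:R)%:E | k in
    [set k | forall y, y \in `[0, 1[ ->
      exists j, (j <= k)%N /\ circle_dist (iter j (rotation theta) x) y < r]].

Definition cover_exponent theta x r : \bar R :=
  (lne (cover_time theta r x) / (- ln r)%:E)%E.

Implicit Type mu : {measure set (measurableTypeR R) -> \bar R}.

Definition circle_supp mu : set R :=
  [set x | (x \in `[0, 1[) /\ forall r, 0 < r -> (0 < mu (circle_ball x r))%E].

Definition is_min_ball_measure mu r (m : \bar R) : Prop :=
  (exists2 x, circle_supp mu x & mu (circle_ball x r) = m) /\
  (forall x, circle_supp mu x -> (m <= mu (circle_ball x r))%E).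

(* [M] is determined by [mu] at every [r > 0], and only those values enter the
   limits, so [d] is determined by [mu]. *)
Definition is_dim_M mu (d : \bar R) : Prop :=
  exists M : R -> \bar R,
    [/\ forall r, 0 < r -> is_min_ball_measure mu r (M r),
        limf_esup (fun r => lne (M r) / (ln r)%:E)%E 0^'+ = d &
        limf_einf (fun r => lne (M r) / (ln r)%:E)%E 0^'+ = d].

End circle_rotation.

Definition circle_lebesgue (R : realType) :
    {measure set (measurableTypeR R) -> \bar R} :=
  mrestr lebesgue_measure
    (measurable_itv `[0%R, 1%R[ : measurable (`[0, 1[%classic : set (measurableTypeR R))).

(* Main.v *)
(** The orbit of [x] is the orbit of [0] shifted by [x], so everything holds for
    every [x].
    If [p / q] is reduced and [|q theta - p| <= 1 / q], the points [j theta] with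
    [j < q] lie within [1 / q] of the points [j p / q], which exhaust the
    multiples of [1 / q] mod 1; hence [tau_(2/q) <= q].  If moreover
    [|q theta - p| = delta], the points [j theta] with [j <= 1 / (4 delta)] stay
    within [1 / (4 q)] of the multiples of [1 / q], so they miss the ball of
    radius [1 / (4 q)] around [1 / (2 q)]; hence [tau_(1/(4q)) > 1 / (4 delta)].
    The first bound along all reduced Dirichlet approximations gives
    [liminf <= 1], and the second along [q] with [delta < q ^ - beta / 4] gives
    [limsup >= beta].  Counting balls gives [liminf >= 1].
    Finally, if [|n theta| >= c n ^ - beta] for all [n], Dirichlet's theorem with
    denominators up to about [Q ^ beta / c] produces a reduced [p / q] whose [q]
    cannot be below [Q]; with [Q ~ 2 / r], [tau_r <= q] is at most a constant
    times [r ^ - beta]. *)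

Require Import Defs.
From mathcomp Require Import all_boot all_order all_algebra.
From mathcomp Require Import all_classical all_reals all_analysis.
From mathcomp Require Import ring lra zify.
Import Order.TTheory GRing.Theory Num.Theory.
Import numFieldNormedType.Exports.

Local Open Scope classical_set_scope.
Local Open Scope ring_scope.

(** * Reduced rational approximations and density of the orbit *)

(** Pigeonhole puts two of the [N + 1] fractional parts of [i t] into one of [N] boxes. The
    resulting fraction is then reduced, because [orbit_dense] inverts [p] modulo [q]. *)
Lemma dirichlet_approximation (R : realType) (t : R) (N : nat) : (0 < N)%N ->
  exists (q : nat) (p : int),
    [/\ (0 < q <= N)%N, coprimez p q & `|q%:R * t - p%:~R| < N%:R^-1].
Proof.
move=> N0; have N0R : 0 < N%:R :> R by rewrite ltr0n.
pose fr i := i%:R * t - (Num.floor (i%:R * t))%:~R.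
have fr0 i : 0 <= fr i < 1.
  rewrite /fr subr_ge0 floor_le /= ltrBlDl.
  by rewrite [X in _ < X](_ : _ = (Num.floor (i%:R * t) + 1)%:~R) ?floorD1_gt // intrD.
have trN i : (Num.truncn (N%:R * fr i) < N)%N.
  have /andP[f0 f1] := fr0 i.
  by rewrite truncn_lt_nat ?mulr_ge0 // gtr_pMr.
pose f (i : 'I_N.+1) : 'I_N := Ordinal (trN i).
have [i [j [ij fij]]] : exists i j : 'I_N.+1, (j < i)%N /\ f i = f j.
  apply: contrapT => noij.
  have finj : injective f.
    move=> i j fij; apply/val_inj => /=.
    by have [lt|lt|//] := ltngtP i j; exfalso; apply: noij; [exists j, i|exists i, j].
  by have := leq_card f finj; rewrite !card_ord ltnn.
pose q := (i - j)%N; pose p : int := Num.floor (i%:R * t) - Num.floor (j%:R * t).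
have q0 : (0 < q)%N by rewrite subn_gt0.
have qN : (q <= N)%N by rewrite (leq_trans (leq_subr _ _)) // -ltnS.
have qp : `|q%:R * t - p%:~R| < N%:R^-1.
  have -> : q%:R * t - p%:~R = fr i - fr j.
    by rewrite /q /p /fr natrB 1?ltnW // intrB; ring.
  rewrite -(ltr_pM2l N0R) mulfV ?gt_eqF // -{1}[N%:R]ger0_norm 1?ltW // -normrM.
  have /andP[fi0 _] := fr0 i; have /andP[fj0 _] := fr0 j.
  have /andP[] := truncn_itv (mulr_ge0 (ltW N0R) fi0).
  have /andP[] := truncn_itv (mulr_ge0 (ltW N0R) fj0).
  have -> : Num.truncn (N%:R * fr i) = Num.truncn (N%:R * fr j).
    exact: (congr1 val fij).
  by rewrite -!natr1 (mulrBr _ (fr i)) ltr_norml => *; apply/andP; split; lra.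
(* Dividing [p] and [q] by [g] also divides the error by [g], so both bounds survive. *)
pose g := gcdn `|p|%N q.
have g0 : (0 < g)%N by rewrite gcdn_gt0 q0 orbT.
have /dvdnP[q' qE] : (g %| q)%N by exact: dvdn_gcdr.
have /dvdzP[p' pE] : (g%:Z %| p)%Z by rewrite /dvdz; apply: dvdn_gcdl.
have q'0 : (0 < q')%N by move: q0; rewrite qE muln_gt0 => /andP[].
have g1R : 1 <= g%:R :> R by rewrite ler1n.
exists q', p'; split.
- by rewrite q'0 (leq_trans _ qN) // qE leq_pmulr.
- apply/coprimezP; have [u [v uv]] := Bezoutz p q.
  exists (u, v) => /=; apply: (@mulIf _ (g%:Z)); first by rewrite eqz_nat -lt0n.
  by rewrite mul1r mulrDl -!mulrA -pE -PoszM -qE uv.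
- apply: le_lt_trans qp; rewrite pE qE intrM natrM.
  have -> : q'%:R * g%:R * t - p'%:~R * g%:R = (q'%:R * t - p'%:~R) * g%:R by ring.
  by rewrite normrM (ger0_norm (ler0n R g)) ler_peMr.
Qed.

(** By Bezout, some [j < q] has [j p / q] equal modulo 1 to [z] rounded down to a multiple of
    [1 / q]. This rounding and the replacement of [t] by [p / q] each cost less than [1 / q]. *)
Lemma orbit_dense (R : realType) (t : R) (q : nat) (p : int) (z : R) :
  (0 < q)%N -> coprimez p q -> `|q%:R * t - p%:~R| <= q%:R^-1 ->
  exists j (m : int), (j < q)%N /\ `|j%:R * t - z - m%:~R| < 2 / q%:R.
Proof.
move=> q0 /coprimezP[[u v] /= uv] qp; have q0R : 0 < q%:R :> R by rewrite ltr0n.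
have q0Z : 0 < q%:Z by [].
set i := Num.floor (z * q%:R).
have jlt := ltz_pmod (i * u) q0Z; have jge := modz_ge0 (i * u) (lt0r_neq0 q0Z).
set j := `|((i * u) %% q)%Z|%N.
have jE : j%:Z = ((i * u) %% q)%Z by rewrite gez0_abs.
have jq : (j < q)%N by rewrite -ltz_nat jE.
(* Substituting [u p = 1 - v q] in [j p] gives [j p = i + m q]. *)
pose m := - i * v - ((i * u) %/ q)%Z * p.
have jp : j%:Z * p = i + m * q.
  have := divz_eq (i * u) q; rewrite -jE => dE.
  have -> : j%:Z = i * u - ((i * u) %/ q)%Z * q by rewrite [X in X - _]dE addrC addKr.
  rewrite /m -[X in _ = X + _]mulr1 -uv; ring.
exists j, m; split=> //.
set e := q%:R * t - p%:~R in qp *.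
have jpR : j%:R * p%:~R = i%:~R + m%:~R * q%:R :> R.
  have := congr1 (fun k : int => k%:~R : R) jp.
  by rewrite intrM intrD intrM.
have iz : i%:~R <= z * q%:R < i%:~R + 1.
  rewrite floor_le /= [X in _ < X](_ : _ = (i + 1)%:~R) ?floorD1_gt // intrD //.
have je : `|j%:R * e| < 1.
  rewrite normrM ger0_norm //; apply: (@le_lt_trans _ _ (j%:R * q%:R^-1)).
    by rewrite ler_wpM2l.
  by rewrite ltr_pdivrMr // mul1r ltr_nat.
rewrite ltr_pdivlMr // -[X in _ * X]ger0_norm ?ltW // -normrM.
have -> : (j%:R * t - z - m%:~R) * q%:R = j%:R * e + (i%:~R - z * q%:R).
  rewrite /e; have -> : i%:~R = j%:R * p%:~R - m%:~R * q%:R :> R by rewrite jpR; ring.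
  ring.
move: je; rewrite !ltr_norml => /andP[? ?]; case/andP: iz => ? ?; apply/andP; split; lra.
Qed.

(** * Cover times and rational approximations *)

Definition covers {R : realType} (theta r x : R) (k : nat) : Prop :=
  forall y, y \in `[0, 1[ ->
    exists j, (j <= k)%N /\ circle_dist (iter j (rotation theta) x) y < r.

Lemma dist_int_ltP (R : realType) (t r : R) :
  dist_int t < r <-> exists m : int, `|t - m%:~R| < r.
Proof.
have [[m0 dE] dle] := dist_intP t; split=> [dr|[m mr]].
  by exists m0; rewrite -dE.
exact: le_lt_trans (dle m) mr.
Qed.

Lemma dist_int_ge0 (R : realType) (t : R) : 0 <= dist_int t.
Proof. by have [[m ->] _] := dist_intP t. Qed.

Lemma iter_rotation (R : realType) (theta x : R) (j : nat) :
  exists m : int, iter j (rotation theta) x = x + j%:R * theta - m%:~R.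
Proof.
elim: j => [|j [m IH]]; first by exists 0; rewrite mul0r addr0 subr0.
rewrite iterS IH /rotation; set f := Num.floor _.
by exists (m + f); rewrite intrD -natr1; ring.
Qed.

(** The integers removed by [rotation] are absorbed into [m], which moves the orbit to the real
    line. *)
Lemma circle_dist_iterP (R : realType) (theta x y r : R) (j : nat) :
  circle_dist (iter j (rotation theta) x) y < r <->
  exists m : int, `|x + j%:R * theta - y - m%:~R| < r.
Proof.
have [m0 ->] := iter_rotation R theta x j; rewrite dist_int_ltP.
split=> -[m mr]; [exists (m + m0)|exists (m - m0)]; apply: le_lt_trans mr;
  by rewrite ?intrB ?intrD le_eqVlt; apply/orP; left; apply/eqP; congr `|_|; ring.
Qed.

Lemma covers_coprime_approx (R : realType) (theta r x : R) (q : nat) (p : int) :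
  (0 < q)%N -> coprimez p q -> `|q%:R * theta - p%:~R| <= q%:R^-1 ->
  2 / q%:R <= r -> covers theta r x q.
Proof.
move=> q0 pq qp qr y _.
have [j [m [jq jm]]] := orbit_dense R theta q p (y - x) q0 pq qp.
exists j; split; first exact: ltnW.
apply/circle_dist_iterP; exists m; apply: lt_le_trans qr.
by apply: le_lt_trans jm; rewrite opprB addrA (addrC (j%:R * theta)).
Qed.

(** With [N] the integer part of [1 / (2 r)], the points [i / N] are at least [2 r] apart on the
    circle, so each orbit point is within [r] of at most one of them. Hence [N <= k + 1], and
    [1 / (2 r) < N + 1]. *)
Lemma covers_ge_inv_radius (R : realType) (theta r x : R) (k : nat) :
  0 < r -> covers theta r x k -> (2 * r)^-1 < k.+2%:R.
Proof.
move=> r0 cov; have r20 : 0 < (2 * r)^-1 by rewrite invr_gt0 mulr_gt0.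
set N := Num.truncn (2 * r)^-1.
have /andP[Nle Nlt] := truncn_itv (ltW r20).
apply: lt_le_trans Nlt _; rewrite ler_nat ltnS -/N.
rewrite leqNgt; apply/negP => kN.
have N0 : 0 < N%:R :> R by rewrite ltr0n; exact: leq_ltn_trans kN.
have point (i : 'I_N) : exists j : 'I_k.+1, exists m : int,
    `|x + j%:R * theta - i%:R / N%:R - m%:~R| < r.
  have /cov[j [jk /circle_dist_iterP[m jm]]] : (i%:R / N%:R : R) \in `[0, 1[.
    by rewrite in_itv /= divr_ge0 //= ltr_pdivrMr // mul1r ltr_nat.
  have jk' : (j < k.+1)%N by [].
  by exists (Ordinal jk'), m.
have [f fP] := choice point.
suff /(leq_card f) : injective f by rewrite !card_ord leqNgt kN.
move=> i1 i2 f12; have [m1 h1] := fP i1; have [m2 h2] := fP i2.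
move: h2; rewrite -f12 => h2; apply/val_inj => /=.
(* Two targets served by the same orbit point differ by less than [2 r <= 1 / N] modulo 1. Scaled by
   [N], the difference is an integer below 1 in absolute value, hence 0. *)
have : `|i1%:R - i2%:R - (m2 - m1)%:~R * N%:R| < 1 :> R.
  have -> : i1%:R - i2%:R - (m2 - m1)%:~R * N%:R =
    ((x + (f i1)%:R * theta - i2%:R / N%:R - m2%:~R) -
     (x + (f i1)%:R * theta - i1%:R / N%:R - m1%:~R)) * N%:R :> R.
    by rewrite intrB; field; rewrite gt_eqF.
  rewrite normrM (ger0_norm (ltW N0)).
  have Nr : r + r <= N%:R^-1.
    by rewrite (_ : r + r = 2 * r); [rewrite -[X in X <= _]invrK lef_pV2 ?posrE|ring].
  rewrite -ltr_pdivlMr // mul1r; apply: lt_le_trans Nr.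
  by apply: le_lt_trans (ler_normB _ _) _; exact: ltrD.
have -> : i1%:R - i2%:R - (m2 - m1)%:~R * N%:R =
    (i1%:Z - i2%:Z - (m2 - m1) * N%:Z)%:~R :> R by rewrite !(intrB, intrM).
rewrite -intr_norm -[1]/(1%:~R) ltr_int.
move: (m2 - m1) => m mlt.
have := ltn_ord i1; have := ltn_ord i2; move: mlt.
move: (nat_of_ord i1) (nat_of_ord i2) => a b ab bN aN.
have {}ab : a%:Z - b%:Z = m * N%:Z by lia.
have [m0|m0|m0] := ltgtP m 0; [nia|nia|].
by move: ab; rewrite m0 mul0r; lia.
Qed.

Lemma covers_gt_quarter (R : realType) (theta x : R) (q k : nat) (p : int) :
  (0 < q)%N -> covers theta (4 * q%:R)^-1 x k ->
  4^-1 < k%:R * `|q%:R * theta - p%:~R|.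
Proof.
move=> q0 cov; have q0R : 0 < q%:R :> R by rewrite ltr0n.
(* The test point is halfway between [x] and [x + 1 / q], and [f] brings it back to the circle. *)
set w := x + (2 * q%:R)^-1; set f := Num.floor w.
have /cov[j [jk /circle_dist_iterP[m jm]]] : w - f%:~R \in `[0, 1[.
  rewrite in_itv /= subr_ge0 floor_le /= ltrBlDl.
  by rewrite [X in _ < X](_ : _ = (f + 1)%:~R) ?floorD1_gt // intrD.
set e := q%:R * theta - p%:~R.
pose n : int := j%:Z * p + (f - m) * q%:Z.
(* Scaled by [q], the displacement from the test point is an integer minus 1/2, of size at least
   1/2, plus the drift [j e]. The drift must therefore exceed 1/4. *)
have nE : `|n%:~R - 2^-1 + j%:R * e| < 4^-1.
  have -> : n%:~R - 2^-1 + j%:R * e =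
      (x + j%:R * theta - (w - f%:~R) - m%:~R) * q%:R.
    by rewrite /n /w /e !(intrM, intrD, intrB); field; rewrite gt_eqF.
  rewrite normrM (ger0_norm (ltW q0R)) -ltr_pdivlMr //.
  by rewrite -invfM.
apply: (@lt_le_trans _ _ (j%:R * `|e|)); last by rewrite ler_wpM2r // ler_nat.
rewrite -[j%:R]ger0_norm // -normrM.
have n2 : 2^-1 <= `|n%:~R - 2^-1 : R|.
  have [n0|n0] := leP n 0.
    have : n%:~R <= 0 :> R by rewrite lerz0.
    by move=> ?; rewrite ler0_norm; lra.
  have : 1 <= n%:~R :> R by rewrite ler1z.
  by move=> ?; rewrite ger0_norm; lra.
have := lerB_normD (n%:~R - 2^-1 : R) (j%:R * e); lra.
Qed.

Lemma le_cover_time (R : realType) (theta r x : R) (k : nat) :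
  covers theta r x k -> (cover_time theta r x <= k%:R%:E)%E.
Proof. by move=> cov; apply: ereal_inf_lbound; exists k. Qed.

Lemma cover_time_ge (R : realType) (theta r x : R) (K : R) :
  (forall k, covers theta r x k -> K <= k%:R) -> (K%:E <= cover_time theta r x)%E.
Proof. by move=> leK; apply: le_ereal_inf_tmp => _ [k /leK Kk <-]; rewrite lee_fin. Qed.

Lemma cover_exponent_le (R : realType) (theta r x a : R) (k : nat) :
  0 < r < 1 -> (0 < k)%N -> covers theta r x k -> ln k%:R <= a * - ln r ->
  (cover_exponent theta x r <= a%:E)%E.
Proof.
move=> r01 k0 cov ka; have L0 : 0 < - ln r by rewrite oppr_gt0 ln_lt0.
rewrite /cover_exponent /inve gt_eqF // lee_pdivrMr // -EFinM.
apply: (@le_trans _ _ (lne k%:R%:E)); last by rewrite lne_EFin ?ltr0n // lee_fin.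
(* [lee_lne] compares arguments in [[0, +oo]]. *)
have c0 : (0 <= cover_time theta r x)%E by apply: cover_time_ge => ? _; exact: ler0n.
by rewrite lee_lne ?le_cover_time // in_itv /= ?c0 leey // lee_fin ler0n.
Qed.

Lemma cover_exponent_ge (R : realType) (theta r x a K : R) :
  0 < r < 1 -> 0 < K -> (forall k, covers theta r x k -> K <= k%:R) ->
  a * - ln r <= ln K -> (a%:E <= cover_exponent theta x r)%E.
Proof.
move=> r01 K0 /cover_time_ge leK aK; have L0 : 0 < - ln r by rewrite oppr_gt0 ln_lt0.
rewrite /cover_exponent /inve gt_eqF // lee_pdivlMr // -EFinM.
apply: (@le_trans _ _ (lne K%:E)); first by rewrite lne_EFin // lee_fin.
rewrite lee_lne // in_itv /= leey andbT; first by rewrite lee_fin ltW.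
by apply: le_trans leK; rewrite lee_fin ltW.
Qed.

(** * Bounds on upper and lower limits *)

Lemma limf_esup_le (T : choiceType) (X : filteredType T) (R : realType) (f : X -> \bar R)
    (F : set (set X)) (a : \bar R) :
  F [set x | (f x <= a)%E] -> (limf_esup f F <= a)%E.
Proof.
move=> Fa; rewrite limf_esupE; apply: ge_ereal_inf.
exists (ereal_sup (f @` [set x | (f x <= a)%E])).
  by exists [set x | (f x <= a)%E].
by apply: ge_ereal_sup => _ [x xa <-].
Qed.

Lemma limf_esup_ge (T : choiceType) (X : filteredType T) (R : realType) (f : X -> \bar R)
    (F : set (set X)) (a : \bar R) :
  (forall V, F V -> exists2 x, V x & (a <= f x)%E) -> (a <= limf_esup f F)%E.
Proof.
move=> Fa; rewrite limf_esupE; apply: le_ereal_inf_tmp => _ [V /Fa[x Vx ax] <-].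
by apply: le_trans ax _; apply: ereal_sup_ubound; exists x.
Qed.

Lemma limf_einf_ge (T : choiceType) (X : filteredType T) (R : realType) (f : X -> \bar R)
    (F : set (set X)) (a : \bar R) :
  F [set x | (a <= f x)%E] -> (a <= limf_einf f F)%E.
Proof.
move=> Fa; rewrite /limf_einf leeNr; apply: limf_esup_le.
by under eq_set do rewrite leeN2.
Qed.

Lemma limf_einf_le (T : choiceType) (X : filteredType T) (R : realType) (f : X -> \bar R)
    (F : set (set X)) (a : \bar R) :
  (forall V, F V -> exists2 x, V x & (f x <= a)%E) -> (limf_einf f F <= a)%E.
Proof.
move=> Fa; rewrite /limf_einf leeNl; apply: limf_esup_ge => V /Fa[x Vx xa].
by exists x => //; rewrite leeN2.
Qed.

(** Lets [- ln r] absorb the additive constants that appear in the logarithms. *)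
Lemma near0_ln (R : realType) (A : R) : \forall r \near 0^'+, 0 < r < 1 /\ A <= - ln r.
Proof.
have e0 : 0 < Num.min 1 (expR (- A)) by rewrite lt_min ltr01 expR_gt0.
near=> r.
have r0 : 0 < r by near: r; exact: nbhs_right_gt.
have : r < Num.min 1 (expR (- A)) by near: r; exact: nbhs_right_lt.
rewrite lt_min r0 => /andP[-> rA]; split=> //.
by rewrite lerNr -[- A]expRK ler_ln ?posrE ?expR_gt0 // ltW.
Unshelve. all: by end_near. Qed.

(** Reduces the hypotheses of [limf_einf_le] and [limf_esup_ge] at [0^'+] to finding good radii
    below any given [e]. *)
Lemma at_right0_frequently (R : realType) (P : R -> Prop) :
  (forall e, 0 < e -> exists2 r, 0 < r < e & P r) ->
  forall V : set R, 0^'+ V -> exists2 r, V r & P r.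
Proof.
move=> freq V [e /= e0 eV]; have [r /andP[r0 re] Pr] := freq e e0.
exists r => //; apply: eV => //=.
by rewrite sub0r normrN ger0_norm // ltW.
Qed.

Lemma limf_einf_le_esup (T : choiceType) (X : filteredType T) (R : realType)
    (f : X -> \bar R) (F : set (set X)) (FF : ProperFilter F) :
  (limf_einf f F <= limf_esup f F)%E.
Proof.
rewrite limf_einfE; apply: ge_ereal_sup => _ [V FV <-].
apply: limf_esup_ge => W FW; have [x [Vx Wx]] := filter_ex (filterI FV FW).
by exists x => //; apply: ereal_inf_lbound; exists x.
Qed.

(** * Lebesgue measure of circle balls and its dimension *)

Lemma circle_ballE (R : realType) (x r : R) : x \in `[0, 1[ -> r <= 2^-1 ->
  circle_ball x r =
    [set y | (0 <= y < 1) /\ [\/ `|x - y| < r, `|x - y - 1| < r | `|x - y + 1| < r]].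
Proof.
rewrite in_itv /= => /andP[x0 x1] r2; apply/seteqP; split=> y [].
  rewrite in_itv /= => y01 /dist_int_ltP[m mr]; split=> //.
  (* Since [|x - y| < 1] and [r <= 1/2], [|m| < 3/2]. *)
  have /andP[m1 m2] : -1 <= m <= 1.
    case/andP: y01 => y0 y1; move: mr; rewrite ltr_norml => /andP[? ?].
    have : - 2%:~R < m%:~R :> R by lra.
    have : m%:~R < 2%:~R :> R by lra.
    by rewrite -intrN !ltr_int; lia.
  have [m0|] : m = 0 \/ (m = 1 \/ m = -1) by lia.
    by apply: Or31; rewrite m0 subr0 in mr.
  case=> mE; rewrite mE in mr; first exact: Or32.
  by apply: Or33; rewrite intrN opprK in mr.
move=> y01 xyr; split; first by rewrite in_itv.
apply/dist_int_ltP; case: xyr => ?; [exists 0|exists 1|exists (-1)] => //.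
  by rewrite subr0.
by rewrite intrN opprK.
Qed.

Lemma circle_lebesgueE (R : realType) (A : set R) : A `<=` `[0, 1[ ->
  circle_lebesgue R A = lebesgue_measure A.
Proof.
by move=> A01; rewrite -[LHS]/(lebesgue_measure (A `&` `[0, 1[)) setIidl.
Qed.

Lemma circle_lebesgue_ball (R : realType) (x r : R) : x \in `[0, 1[ -> 0 < r <= 2^-1 ->
  circle_lebesgue R (circle_ball x r) = (2 * r)%:E.
Proof.
move=> x01 /andP[r0 r2]; rewrite circle_lebesgueE; last by move=> y [].
have lm (b1 b2 : bool) (a b : R) : a <= b ->
    lebesgue_measure [set` Interval (BSide b1 a) (BSide b2 b)] = (b - a)%:E.
  move=> ab; rewrite lebesgue_measure_itv /= lte_fin.
  by case: ltP => // ba; rewrite (le_anti (introT andP (conj ab ba))) subrr.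
(* Three cases: the ball wraps around below 0, or stays inside, or wraps around above 1. As
   [r <= 1/2], the two pieces of a wrapped ball are disjoint. *)
rewrite circle_ballE //; move: x01; rewrite in_itv /= => /andP[x0 x1].
have [xr|rx] := ltP x r.
  rewrite [X in lebesgue_measure X](_ : _ = `[0, x + r[ `|` `]x - r + 1, 1[); last first.
    apply/seteqP; split=> y /=; rewrite !in_itv /=.
      move=> [/andP[y0 y1]]; rewrite !ltr_norml.
      by case=> /andP[? ?]; [left|exfalso|right]; try (apply/andP; split); lra.
    move=> h; rewrite !ltr_norml; case: h => /andP[h1 h2].
      split; first by apply/andP; split; lra.
      by apply: Or31; apply/andP; split; lra.
    split; first by apply/andP; split; lra.
    by apply: Or33; apply/andP; split; lra.
  rewrite measureU //; last first.
    by apply/seteqP; split=> y //=; rewrite !in_itv /= => -[/andP[? ?] /andP[? ?]]; lra.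
  by rewrite /= !lm -?EFinD; [congr (_%:E); ring|lra..].
have [xr1|xr1] := leP (x + r) 1.
  rewrite [X in lebesgue_measure X](_ : _ = `]x - r, x + r[%classic); last first.
    apply/seteqP; split=> y /=; rewrite !in_itv /=.
      move=> [/andP[y0 y1]]; rewrite !ltr_norml.
      by case=> /andP[? ?]; apply/andP; split; lra.
    move=> /andP[h1 h2]; rewrite !ltr_norml; split; first by apply/andP; split; lra.
    by apply: Or31; apply/andP; split; lra.
  by rewrite lm; [congr (_%:E); ring|lra].
rewrite [X in lebesgue_measure X](_ : _ = `[0, x + r - 1[ `|` `]x - r, 1[); last first.
  apply/seteqP; split=> y /=; rewrite !in_itv /=.
    move=> [/andP[y0 y1]]; rewrite !ltr_norml.
    by case=> /andP[? ?]; [right|left|exfalso]; try (apply/andP; split); lra.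
  move=> h; rewrite !ltr_norml; case: h => /andP[h1 h2].
    split; first by apply/andP; split; lra.
    by apply: Or32; apply/andP; split; lra.
  split; first by apply/andP; split; lra.
  by apply: Or31; apply/andP; split; lra.
rewrite measureU //; last first.
  by apply/seteqP; split=> y //=; rewrite !in_itv /= => -[/andP[? ?] /andP[? ?]]; lra.
by rewrite /= !lm -?EFinD; [congr (_%:E); ring|lra..].
Qed.

(** Circle distances never exceed 1/2, so the ball is the whole circle. [is_dim_M] asks for a
    minimum at every positive radius, including these. *)
Lemma circle_lebesgue_big_ball (R : realType) (x r : R) : x \in `[0, 1[ -> 2^-1 < r ->
  circle_lebesgue R (circle_ball x r) = 1%E.
Proof.
move=> x01 r2; rewrite circle_lebesgueE; last by move=> y [].
rewrite (_ : circle_ball x r = `[0, 1[%classic).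
  by rewrite lebesgue_measure_itv /= lte_fin ltr01 oppr0 adde0.
apply/seteqP; split=> y; first by case.
move=> /= y01; split=> //; move: x01 y01.
rewrite !in_itv /= => /andP[x0 x1] /andP[y0 y1]; apply/dist_int_ltP.
have [h|h] := ltP (x - y) (- 2^-1).
  by exists (-1); rewrite intrN opprK ltr_norml; apply/andP; split; lra.
have [h'|h'] := leP (x - y) 2^-1.
  by exists 0; rewrite subr0 ltr_norml; apply/andP; split; lra.
by exists 1; rewrite ltr_norml; apply/andP; split; lra.
Qed.

Lemma circle_lebesgue_dim_M (R : realType) : is_dim_M (circle_lebesgue R) 1%E.
Proof.
have zero01 : (0 : R) \in `[0, 1[ by rewrite in_itv /= lexx ltr01.
pose M r := circle_lebesgue R (circle_ball 0 r).
have ballE x r : x \in `[0, 1[ -> 0 < r -> circle_lebesgue R (circle_ball x r) = M r.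
  move=> x01 r0; have [r2|r2] := leP r 2^-1.
    by rewrite /M !circle_lebesgue_ball // r0.
  by rewrite /M !circle_lebesgue_big_ball.
have M0 r : 0 < r -> (0 < M r)%E.
  move=> r0; have [r2|r2] := leP r 2^-1.
    by rewrite /M circle_lebesgue_ball ?r0 // lte_fin mulr_gt0.
  by rewrite /M circle_lebesgue_big_ball.
have MP r : 0 < r -> is_min_ball_measure (circle_lebesgue R) r (M r).
  move=> r0; split=> [|x [x01 _]]; last by rewrite ballE.
  by exists 0 => //; split=> // s s0; rewrite ballE // M0.
(* The ratio [ln (2 r) / ln r] in a form showing that it stays below 1 and is at least [1 - e] once
   [- ln r >= ln 2 / e]. *)
have ME r : 0 < r <= 2^-1 -> (lne (M r) / (ln r)%:E)%E = (1 - ln 2 / - ln r)%:E.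
  move=> /andP[r0 r2]; have lnr : ln r < 0 by rewrite ln_lt0 // r0; lra.
  rewrite /M circle_lebesgue_ball // ?r0 // lne_EFin ?mulr_gt0 //.
  rewrite /inve lt_eqF // -EFinM lnM ?posrE //; congr (_%:E).
  by field; rewrite lt_eqF.
have near_half : \forall r \near (0:R)^'+, r <= 2^-1 by exact: nbhs_right_le.
have esup_le : (limf_esup (fun r => lne (M r) / (ln r)%:E) 0^'+ <= 1)%E.
  apply: limf_esup_le; near=> r => /=.
  have [/andP[r0 r1] _] : 0 < r < 1 /\ 0 <= - ln r by near: r; exact: near0_ln.
  rewrite ME; last by rewrite r0; near: r.
  by rewrite lee_fin lerBlDr lerDl divr_ge0 ?ln_ge0 ?ler1n // oppr_ge0 ln_le0 // ltW.
have einf_ge : (1 <= limf_einf (fun r => lne (M r) / (ln r)%:E) 0^'+)%E.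
  apply/lee_subgt0Pr => e e0; apply: limf_einf_ge; near=> r => /=.
  have [/andP[r0 r1] Lr] : 0 < r < 1 /\ ln 2 / e <= - ln r by near: r; exact: near0_ln.
  rewrite ME; last by rewrite r0; near: r.
  have L0 : 0 < - ln r by rewrite oppr_gt0 ln_lt0 // r0.
  rewrite -EFinB lee_fin lerD2l lerN2 ler_pdivrMr // mulrC -ler_pdivrMr //.
have einf_esup := limf_einf_le_esup _ _ _ (fun r => lne (M r) / (ln r)%:E)%E (0:R)^'+ _.
exists M; split=> //; apply/le_anti/andP; split=> //.
  exact: le_trans (einf_esup _).
exact: le_trans (einf_esup _) _.
Unshelve. all: by end_near. Qed.

(** * Consequences of irrationality and of the type *)

Lemma liminf0_frequently (R : realType) (u : nat -> R) :
  limn_einf (fun n => (u n)%:E) = 0%E ->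
  forall e N, 0 < e -> exists n, (N <= n)%N /\ u n < e.
Proof.
move=> u0 e N e0; apply: contrapT => noN.
suff : (e%:E <= limn_einf (fun n => (u n)%:E))%E by rewrite u0 lee_fin leNgt e0.
apply: limf_einf_ge; exists N => // n /= Nn; rewrite lee_fin leNgt; apply/negP => une.
by apply: noN; exists n.
Qed.

Lemma liminf_neq0_lower (R : realType) (u : nat -> R) :
  (forall n, 0 <= u n) -> limn_einf (fun n => (u n)%:E) <> 0%E ->
  exists c N, 0 < c /\ forall n, (N <= n)%N -> c <= u n.
Proof.
move=> u0 uN0; apply: contrapT => noc; apply: uN0; apply/le_anti/andP; split.
  apply/lee_addgt0Pr => e e0; rewrite add0e; apply: limf_einf_le => V [N _ NV].
  apply: contrapT => noV; apply: noc; exists e, N; split=> // n Nn.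
  rewrite leNgt; apply/negP => une; apply: noV; exists n; first exact: NV.
  by rewrite lee_fin ltW.
by apply: limf_einf_ge; exists 0%N => // n _ /=; rewrite lee_fin.
Qed.

Section irrational_rotation.
Variables (R : realType) (theta : R).
Hypothesis theta_irr : irrational theta.

Lemma irrational_approx_gt0 (q : nat) (p : int) : (0 < q)%N -> 0 < `|q%:R * theta - p%:~R|.
Proof.
move=> q0; rewrite normr_gt0; apply/eqP => /eqP; rewrite subr_eq0 => /eqP qp.
apply: theta_irr; apply/rationalP; exists p, q.
by rewrite -qp mulrAC mulfV ?mul1r // pnatr_eq0 -lt0n.
Qed.

(** Only finitely many denominators occur, each at a positive distance. This is what forces
    Dirichlet denominators to be large. *)
Lemma irrational_approx_lower (Q : nat) :
  exists2 m, 0 < m & forall (j : nat) (p : int), (0 < j < Q)%N -> m <= `|j%:R * theta - p%:~R|.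
Proof.
elim: Q => [|Q [m m0 mP]]; first by exists 1 => // j p; rewrite ltn0 andbF.
have [Q0|Q0] := posnP Q; first by exists 1 => // j p; rewrite Q0 ltnS; case: j.
have [[p0 dE] dle] := dist_intP (Q%:R * theta).
exists (Num.min m (dist_int (Q%:R * theta))).
  by rewrite lt_min m0 dE irrational_approx_gt0.
move=> j p /andP[j0]; rewrite ltnS leq_eqVlt => /predU1P[->|jQ].
  by rewrite ge_min dle orbT.
by rewrite ge_min mP ?j0.
Qed.

(** Dirichlet with [N] just above [1 / m] gives an error below [m], which excludes denominators
    below [Q]; the bound [q <= N] limits how far [q] overshoots. *)
Lemma large_coprime_approx (Q : nat) (m : R) : 0 < m ->
  (forall (j : nat) (p : int), (0 < j < Q)%N -> m <= `|j%:R * theta - p%:~R|) ->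
  exists (q : nat) (p : int), [/\ (0 < q)%N, (Q <= q)%N, q%:R <= m^-1 + 1,
    coprimez p q & `|q%:R * theta - p%:~R| <= q%:R^-1].
Proof.
move=> m0 mP; set N := (Num.truncn m^-1).+1.
have [q [p [/andP[q0 qN] pq qp]]] := dirichlet_approximation R theta N isT.
have im0 : 0 <= m^-1 by rewrite invr_ge0 ltW.
have /andP[Nle Nlt] := truncn_itv im0.
exists q, p; split=> //.
- rewrite leqNgt; apply/negP => qQ; have := mP q p; rewrite q0 qQ => /(_ isT).
  apply/negP; rewrite -ltNge; apply: lt_trans qp _.
  by rewrite -[m]invrK ltf_pV2 ?posrE ?invr_gt0 // ltr0n.
- apply: (@le_trans _ _ N%:R); first by rewrite ler_nat.
  by rewrite /N -natr1 lerD2r.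
- apply: le_trans (ltW qp) _.
  by rewrite lef_pV2 ?posrE ?ltr0n // ler_nat.
Qed.

Lemma irrational_type_lower (beta : R) :
  0 <= beta -> (irrational_type theta < beta%:E)%E ->
  exists2 c, 0 < c <= 1 &
    forall (n : nat) (p : int), (0 < n)%N -> c <= n%:R `^ beta * `|n%:R * theta - p%:~R|.
Proof.
move=> beta0 ltbeta.
pose u (n : nat) := n%:R `^ beta * dist_int (n%:R * theta).
have u0 n : 0 <= u n by rewrite mulr_ge0 ?powR_ge0 ?dist_int_ge0.
have [c [N [c0 cP]]] : exists c N, 0 < c /\ forall n, (N <= n)%N -> c <= u n.
  apply: liminf_neq0_lower => // lim0; move: ltbeta; apply/negP; rewrite -leNgt.
  by apply: ereal_sup_ubound; exists beta.
have [m m0 mP] := irrational_approx_lower N.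
(* [c] serves the indices from [N] on and [m] the earlier ones, where [n ^ beta >= 1]. The 1 gives
   [c <= 1], used later for [1 <= 1 / c]. *)
exists (Num.min 1 (Num.min c m)); first by rewrite !lt_min ltr01 c0 m0 ge_min lexx.
move=> n p n0; have [[_ _] dle] := dist_intP (n%:R * theta).
rewrite !ge_min; have [nN|Nn] := ltnP n N.
  have mn : m <= `|n%:R * theta - p%:~R| by apply: mP; rewrite n0.
  apply/orP; right; apply/orP; right; apply: le_trans mn _; rewrite ler_peMl //.
  by rewrite -[leLHS](powRr0 n%:R) ler_powR // ler1n.
apply/orP; right; apply/orP; left; apply: le_trans (cP _ Nn) _.
by rewrite ler_wpM2l ?powR_ge0.
Qed.

(** * Lower and upper limits of the cover exponent *)

Lemma liminf_cover_exponent_ge1 (x : R) : (1 <= limf_einf (cover_exponent theta x) 0^'+)%E.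
Proof.
apply/lee_subgt0Pr => e e0; apply: limf_einf_ge; near=> r => /=.
(* [r <= 1/8] gives [1 / (2 r) - 2 >= 1 / (4 r)], and [ln 4 / e] absorbs the factor 4. *)
have [/andP[r0 r1] Lr] : 0 < r < 1 /\ Num.max (ln 8) (ln 4 / e) <= - ln r.
  by near: r; exact: near0_ln.
move: Lr; rewrite ge_max => /andP[L8]; rewrite ler_pdivrMr // => L4.
have r8 : r <= 8^-1.
  by rewrite -ler_ln ?posrE // lnV ?posrE // lerNr.
have r4 : 0 < 4 * r by rewrite mulr_gt0.
rewrite -EFinB; apply: (@cover_exponent_ge _ _ _ _ _ (4 * r)^-1).
- by rewrite r0.
- by rewrite invr_gt0.
- move=> k /(covers_ge_inv_radius _ _ _ _ _ r0).
  have -> : k.+2%:R = k%:R + 2 :> R by rewrite -[in LHS]addn2 natrD.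
  have -> : (2 * r)^-1 = (4 * r)^-1 + (4 * r)^-1 by field; rewrite gt_eqF.
  have : 2 <= (4 * r)^-1 by rewrite -[2]invrK lef_pV2 ?posrE ?invr_gt0 //; lra.
  lra.
- rewrite lnV ?posrE // lnM ?posrE //; lra.
Unshelve. all: by end_near. Qed.

Lemma liminf_cover_exponent_le1 (x : R) : (limf_einf (cover_exponent theta x) 0^'+ <= 1)%E.
Proof.
apply/lee_addgt0Pr => e e0; apply: limf_einf_le; apply: at_right0_frequently => d d0.
(* [q >= A] is equivalent to [ln q <= (1 + e) (ln q - ln 2)], the bound wanted at radius [2 / q]. *)
set A := expR ((1 + e) * ln 2 / e); have A0 : 0 < A by exact: expR_gt0.
have d20 : 0 < 2 / d by rewrite divr_gt0.
(* The three summands make the radius [2 / q] less than 1, make it less than [d], and make [q]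
   exceed [A]. *)
have [m m0 mP] := irrational_approx_lower (Num.truncn (2 + 2 / d + A)).+1.
have [q [p [q0 Qq _ pq qp]]] := large_coprime_approx _ _ m0 mP.
have qB : 2 + 2 / d + A < q%:R.
  by apply: lt_le_trans (truncnS_gt _) _; rewrite ler_nat.
have q0R : 0 < q%:R :> R by rewrite ltr0n.
exists (2 / q%:R).
  rewrite divr_gt0 //= ltr_pdivrMr // mulrC -ltr_pdivrMr //; lra.
rewrite -EFinD; apply: (@cover_exponent_le _ _ _ _ _ q) => //.
- by rewrite divr_gt0 //= ltr_pdivrMr // mul1r; lra.
- exact: covers_coprime_approx pq qp _.
- have : (1 + e) * ln 2 / e <= ln q%:R.
    by rewrite -[leLHS]expRK -/A ler_ln ?posrE //; lra.
  rewrite ler_pdivrMr // ln_div ?posrE //; lra.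
Qed.

Lemma limsup_cover_exponent_le_type (x : R) : (1 < irrational_type theta)%E ->
  (limf_esup (cover_exponent theta x) 0^'+ <= irrational_type theta)%E.
Proof.
case tE : (irrational_type theta) => [b| |]; rewrite ?leey // lte_fin => b1.
(* Half of [e] puts [beta] above the type; the other half absorbs the constants [2 / c] and
   [3 ^ beta]. *)
apply/lee_addgt0Pr => e e0; set beta := b + e / 2.
have beta0 : 0 <= beta by rewrite /beta; lra.
have [|c /andP[c0 c1] cP] := irrational_type_lower _ beta0.
  by rewrite tE lte_fin /beta; lra.
apply: limf_esup_le; near=> r => /=.
have [/andP[r0 r1] Lr] : 0 < r < 1 /\ (ln (2 / c) + beta * ln 3) / (e / 2) <= - ln r.
  by near: r; exact: near0_ln.
have r20 : 0 < 2 / r by rewrite divr_gt0.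
(* [Q > 2 / r] ensures [2 / q <= r] for every [q >= Q]; as [r < 1], also
   [Q <= 2 / r + 1 <= 3 / r]. *)
set Q := (Num.truncn (2 / r)).+1.
have Qgt : 2 / r < Q%:R by exact: truncnS_gt.
have ir1 : 1 <= r^-1 by rewrite invf_ge1 // ltW.
have Qle : Q%:R <= 3 / r.
  have /andP[h _] := truncn_itv (ltW r20); rewrite /Q -natr1; lra.
have Q0 : 0 < Q%:R :> R by rewrite ltr0n.
have QB0 : 0 < Q%:R `^ beta by exact: powR_gt0.
have QB1 : 1 <= Q%:R `^ beta by rewrite -[leLHS](powRr0 Q%:R) ler_powR // ler1n.
have mQ0 : 0 < c / Q%:R `^ beta by rewrite divr_gt0.
have [q [p [q0 Qq qle pq qp]]] : exists (q : nat) (p : int),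
    [/\ (0 < q)%N, (Q <= q)%N, q%:R <= (c / Q%:R `^ beta)^-1 + 1,
    coprimez p q & `|q%:R * theta - p%:~R| <= q%:R^-1].
  apply: large_coprime_approx => // j p /andP[j0 jQ].
  rewrite ler_pdivrMr // mulrC; apply: le_trans (cP j p j0) _.
  by rewrite ler_wpM2r // ge0_ler_powR ?nnegrE ?ler0n // ler_nat ltnW.
have q0R : 0 < q%:R :> R by rewrite ltr0n.
rewrite -EFinD; apply: (@cover_exponent_le _ _ _ _ _ q) => //; first by rewrite r0.
  apply: covers_coprime_approx pq qp _ => //.
  rewrite ler_pdivrMr // mulrC -ler_pdivrMr //; apply: le_trans (ltW Qgt) _.
  by rewrite ler_nat.
have r30 : 0 < 3 / r by rewrite divr_gt0.
(* The [+ 1] in the bound on [q] is at most [Q ^ beta / c], which costs the factor 2. *)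
have : q%:R <= 2 / c * (3 / r) `^ beta.
  apply: le_trans qle _; rewrite invf_div.
  have ic1 : 1 <= c^-1 by rewrite invf_ge1.
  apply: (@le_trans _ _ (2 / c * Q%:R `^ beta)).
    have : 1 <= Q%:R `^ beta / c by exact: mulr_ege1.
    by rewrite -mulrA (mulrC c^-1); lra.
  rewrite ler_wpM2l ?divr_ge0 ?(ltW c0) //.
  by rewrite ge0_ler_powR ?nnegrE ?ler0n // ltW.
have rhs0 : 0 < 2 / c * (3 / r) `^ beta by rewrite mulr_gt0 ?divr_gt0 ?powR_gt0.
rewrite -(ler_ln (x := q%:R)) ?posrE // => /le_trans; apply; rewrite lnM ?posrE ?powR_gt0 ?divr_gt0 //.
rewrite ln_powR (ln_div (x := 3)) ?posrE //.
move: Lr; rewrite ler_pdivrMr ?divr_gt0 // /beta; lra.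
Unshelve. all: by end_near. Qed.

Lemma type_le_limsup_cover_exponent (x : R) :
  (irrational_type theta <= limf_esup (cover_exponent theta x) 0^'+)%E.
Proof.
apply: ge_ereal_sup => _ [beta /= beta_lim <-].
apply/lee_subgt0Pr => e e0; apply: limf_esup_ge; apply: at_right0_frequently => d d0.
(* [n >= A] gives [beta ln 4 <= e ln n], hence [(beta - e) ln (4 n) <= beta ln n]. *)
set A := expR (beta * ln 4 / e); have A0 : 0 < A by exact: expR_gt0.
have id0 : 0 < d^-1 by rewrite invr_gt0.
(* The threshold 1/4 matches [covers_gt_quarter]: a covering [k] satisfies [k ||n theta|| > 1/4 > n
   ^ beta ||n theta||], so [k > n ^ beta]. *)
have [n [Nn nlt]] := liminf0_frequently _ _ beta_lim 4^-1
  (Num.truncn (1 + d^-1 + A)).+1 (ltac:(by rewrite invr_gt0)).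
have nB : 1 + d^-1 + A < n%:R.
  by apply: lt_le_trans (truncnS_gt _) _; rewrite ler_nat.
have n0R : 0 < n%:R :> R by lra.
have n0 : (0 < n)%N by rewrite -(ltr0n R).
have [[p dE] _] := dist_intP (n%:R * theta).
exists (4 * n%:R)^-1.
  rewrite invr_gt0 mulr_gt0 //= -[d]invrK ltf_pV2 ?posrE ?mulr_gt0 //; lra.
rewrite -EFinB; apply: (@cover_exponent_ge _ _ _ _ _ (n%:R `^ beta)).
- by rewrite invr_gt0 mulr_gt0 //= invf_lt1 ?mulr_gt0 //; lra.
- exact: powR_gt0.
- move=> k /(covers_gt_quarter _ _ _ _ _ p n0); rewrite -dE => lek.
  have dn0 : 0 < dist_int (n%:R * theta) by rewrite dE irrational_approx_gt0.
  by rewrite -(ler_pM2r dn0) ltW // (lt_trans nlt).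
- have : beta * ln 4 / e <= ln n%:R.
    by rewrite -[leLHS]expRK -/A ler_ln ?posrE //; lra.
  have : 0 <= ln 4 :> R by rewrite ln_ge0 // ler1n.
  rewrite ler_pdivrMr // lnV ?posrE ?mulr_gt0 // lnM ?posrE // ln_powR => l4 h.
  have : 0 <= e * ln 4 by rewrite mulr_ge0 // ltW.
  lra.
Qed.

End irrational_rotation.

Theorem theorem5p4 (R : realType) (theta : R)
    (theta01 : 0 < theta < 1) (theta_irr : irrational theta)
    (type_gt1 : (1 < irrational_type theta)%E) :
  is_dim_M (circle_lebesgue R) 1%E /\
  {ae circle_lebesgue R, forall x : R, x \in `[0, 1[ ->
    [/\ limf_einf (cover_exponent theta x) 0^'+ = 1%E,
        (1 < irrational_type theta)%E &
        limf_esup (cover_exponent theta x) 0^'+ = irrational_type theta]}.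
Proof.
split; first exact: circle_lebesgue_dim_M.
apply: aeW => x _; split=> //; apply/le_anti/andP; split.
- exact: liminf_cover_exponent_le1.
- exact: liminf_cover_exponent_ge1.
- exact: limsup_cover_exponent_le_type.
- exact: type_le_limsup_cover_exponent.
Qed.
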